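(* Let $Y\in\mathcal{G}$. Then for all $n\in\mathbb{N}_0$ and $x\ge0$, $$W_n^Y(x)=\int_0^\infty B_n^Y(xv)\,e^{-v}\,dv=\mathbb{E}_V\left[B_n^Y(xV)\right],$$ where $V$ is a standard exponential random variable with density $f(v)=e^{-v}$, $v\ge0$, and $\mathbb{E}_V$ denotes expectation with respect to $V$.
   Context: $\mathbb{N}_0=\{0,1,2,\dots\}$. $\mathcal{G}$ is the set of real random variables $Y$ such that $\mathbb{E}|Y|^n<\infty$ for all $n\in\mathbb{N}_0$ and, for some $r>0$, $\lim_{n\to\infty}|t|^n\mathbb{E}|Y|^n/n!=0$ for all $|t|<r$. Let $Y_1,Y_2,\dots$ be i.i.d. copies of $Y$, $S_0=0$ and $S_i=Y_1+\cdots+Y_i$ for $i\ge1$. The convention $0^0=1$ is used. For $x\ge0$ the probabilistic Fubini polynomials associated with $Y$ are $$W_n^Y(x)=\sum_{i=0}^{\infty}\mathbb{E}[S_i^n]\,P\{G_{\eta(x)}=i+1\}=\sum_{i=0}^\infty \mathbb{E}[S_i^n]\,\frac{1}{1+x}\left(\frac{x}{1+x}\right)^i,$$ where $\eta(x)=1/(1+x)$ and $G_p$ is geometric with $P\{G_p=i\}=p(1-p)^{i-1}$, $i\ge1$. The probabilistic Stirling numbers of the second kind are $$S_Y(n,k)=\frac{1}{k!}\sum_{j=0}^k(-1)^{k-j}\binom{k}{j}\mathbb{E}S_j^n,$$ and the probabilistic Bell polynomials are $B_n^Y(x)=\sum_{k=0}^n S_Y(n,k)x^k$. *)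

(* Defs.v *)
From HB Require Import structures.
From mathcomp Require Import all_boot all_order all_algebra.
From mathcomp Require Import all_classical all_reals all_analysis.

Set Implicit Arguments.
Unset Strict Implicit.
Unset Printing Implicit Defensive.

Import Order.TTheory GRing.Theory Num.Theory.
Import numFieldNormedType.Exports.

Local Open Scope classical_set_scope.
Local Open Scope ring_scope.

Section random_variables.
Context {d : measure_display} {T : measurableType d} {R : realType}.
Variable P : probability T R.

(* The class $\mathcal{G}$. The moments are extended reals; [fine] is harmless
   in the second condition since the first one makes them finite. *)
Definition class_G (Y : {RV P >-> R}) : Prop :=
  (forall n : nat, ('E_P[fun w => (`|Y w| ^+ n)%R] < +oo)%E) /\
  exists2 r : R, 0 < r &
    forall t : R, `|t| < r ->
      (`|t| ^+ n * fine 'E_P[fun w => (`|Y w| ^+ n)%R] / n`!%:R) @[n --> \oo] --> 0.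

(* Mutual independence: the product rule over every finite subfamily. *)
Definition mutually_independent (Ys : nat -> {RV P >-> R}) : Prop :=
  forall (I : seq nat) (B : nat -> set R),
    uniq I -> (forall i, measurable (B i)) ->
    P (\bigcap_(i in [set` I]) (Ys i @^-1` B i)) =
      (\prod_(i <- I) P (Ys i @^-1` B i))%E.

End random_variables.

(* [distribution] is a function on all sets, whose values on non-measurable
   sets are meaningless; hence the restriction to measurable sets. *)
Definition same_distribution {d d' : measure_display}
    {T : measurableType d} {T' : measurableType d'} {R : realType}
    (P : probability T R) (P' : probability T' R)
    (X : {RV P >-> R}) (X' : {RV P' >-> R}) : Prop :=
  forall A : set R, measurable A -> distribution P X A = distribution P' X' A.

(* [Ys i] stands for $Y_{i+1}$; the copies may live on another probability
   space than $Y$. *)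
Definition iid_copies {d d' : measure_display}
    {T : measurableType d} {T' : measurableType d'} {R : realType}
    (P : probability T R) (P' : probability T' R)
    (Y : {RV P >-> R}) (Ys : nat -> {RV P' >-> R}) : Prop :=
  mutually_independent Ys /\ forall i, same_distribution (Ys i) Y.

Definition standard_exponential {d : measure_display} {T : measurableType d}
    {R : realType} (Q : probability T R) (V : {RV Q >-> R}) : Prop :=
  forall A : set R, measurable A -> distribution Q V A = exponential_prob 1 A.

Definition geometric_pmf {R : realType} (p : R) (i : nat) : R :=
  p * (1 - p) ^+ i.-1.

Definition eta {R : realType} (x : R) : R := 1 / (1 + x).

Lemma geometric_pmf_eta {R : realType} (x : R) (i : nat) : 0 <= x ->
  geometric_pmf (eta x) i.+1 = 1 / (1 + x) * (x / (1 + x)) ^+ i.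
Proof.
move=> x0; rewrite /geometric_pmf /eta /=; congr (_ * _ ^+ _).
have x1 : 1 + x != 0 by rewrite gt_eqF// ltr_pwDl.
by rewrite -{1}(divff x1) -mulrBl addrC addKr.
Qed.

Section probabilistic_polynomials.
Context {d : measure_display} {T : measurableType d} {R : realType}.
Variables (P : probability T R) (Ys : nat -> {RV P >-> R}).

(* $S_i = Y_1 + \dots + Y_i$ *)
Definition partial_sum (i : nat) (w : T) : R := \sum_(j < i) Ys j w.

(* $\mathbb{E}[S_i^n]$; the convention $0^0 = 1$ is that of [^+]. *)
Definition sum_moment (i n : nat) : R :=
  fine 'E_P[fun w => (partial_sum i w ^+ n)%R].

Definition fubini_term (n : nat) (x : R) (i : nat) : R :=
  sum_moment i n * geometric_pmf (eta x) i.+1.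

Definition fubini (n : nat) (x : R) : R := limn (series (fubini_term n x)).

Definition stirling2 (n k : nat) : R :=
  (k`!%:R)^-1 *
    \sum_(j < k.+1) (-1) ^+ (k - j)%N * 'C(k, j)%:R * sum_moment j n.

Definition bell (n : nat) (x : R) : R :=
  \sum_(k < n.+1) stirling2 n k * x ^+ k.

End probabilistic_polynomials.

(* Main.v *)
Require Import Defs.
From HB Require Import structures.
From mathcomp Require Import all_boot all_order all_algebra.
From mathcomp Require Import all_classical all_reals all_analysis.
From mathcomp Require Import measurable_realfun.
From mathcomp Require Import ring.

(** Write m_n(i) for the moment E[S_i^n].  Splitting off the last summand of
    S_(i+1), which is independent of S_i, and expanding the power gives
      m_n(i+1) = sum_(k <= n) C(n, k) E[Y^(n-k)] m_k(i)      ([sum_momentS]).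
    The term k = n is m_n(i), so the forward difference of m_n is a combination
    of m_0, ..., m_(n-1); by induction the (n+1)-st difference of m_n vanishes,
    that is, m_n(i) is a polynomial in i of degree at most n.  Its Newton
    expansion is
      m_n(i) = sum_(k <= n) C(i, k) k! S_Y(n, k)             ([sum_momentE]),
    because k! S_Y(n, k) is by definition the k-th difference of m_n at 0.

    Now both the geometric average and the exponential average act on a finite
    sum over k.  The former sends C(i, k) to x^k
    ([geometric_binomial_moment]), so
      W_n(x) = sum_(k <= n) k! S_Y(n, k) x^k                 ([cvg_fubini]).
    The latter sends v^k to k! ([integral_exprn_expRN]), so the integral of
    B_n(x v) e^(-v) is the same sum ([integral_bell_expRN]).  That this integral
    is an expectation with respect to V is the change of variables from the law
    of V to its density ([expectation_exponential]).

    The probabilistic work lies in the factorisation E[S_i^k Y_(i+1)^l] =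
    E[S_i^k] E[Y_(i+1)^l].  Mutual independence is a statement about events
    only, so S_i is first shown to be independent of every event depending on
    Y_(i+1), ..., Y_N, by induction on i ([partial_sum_indep]): the induction
    step needs the joint law of S_i and Y_(i+1), which is the product of their
    laws since it agrees with it on rectangles ([pair_law_on_event]).  The
    moments then factor by the theorem of Fubini ([indep_expectationM]). *)

Set Implicit Arguments.
Unset Strict Implicit.
Unset Printing Implicit Defensive.

Import Order.TTheory GRing.Theory Num.Theory.
Import numFieldNormedType.Exports.

Local Open Scope classical_set_scope.
Local Open Scope ring_scope.

(** * Finite differences and Newton expansion *)

Section finite_differences.
Variable R : comNzRingType.
Implicit Types f g : nat -> R.

Definition fdiff f : nat -> R := fun i => f i.+1 - f i.

(** Expansion of the k-th power of (shift - identity), evaluated at 0. *)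
Lemma iter_fdiff0E k f : iter k fdiff f 0 =
  \sum_(j < k.+1) (-1) ^+ (k - j)%N * 'C(k, j)%:R * f j.
Proof.
elim: k f => [|k IH] f.
  by rewrite big_ord1 /= subnn expr0 bin0 !mul1r.
rewrite iterSr IH /fdiff.
under eq_bigr do rewrite mulrBr.
rewrite sumrB [RHS]big_ord_recl /= subn0 bin0 mulr1.
under [in RHS]eq_bigr => j _.
  rewrite /bump /= add1n subSS binS natrD mulrDr mulrDl.
  over.
rewrite big_split /= addrA [RHS]addrC; congr (_ + _).
rewrite big_ord_recl big_ord_recr /= (@bin_small k k.+1) //.
rewrite mulr0 mul0r addr0.
rewrite subn0 bin0 mulr1 exprS mulN1r mulNr opprD -sumrN; congr (_ + _).
apply: eq_bigr => j _; rewrite /bump /= add1n.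
have -> : (k - j = (k - j.+1).+1)%N by rewrite subnSK.
by rewrite exprS mulN1r !mulNr.
Qed.

(** Induction on i: f(i+1) = f(i) + (fdiff f)(i), both terms are expanded by the
    induction hypothesis, and the rule of Pascal merges the two expansions; the
    vanishing difference cuts the expansion of [fdiff f] by one term. *)
Lemma newton_forward n f : (forall i, iter n.+1 fdiff f i = 0) ->
  forall i, f i = \sum_(k < n.+1) 'C(i, k)%:R * iter k fdiff f 0.
Proof.
move=> f0 i; elim: i f f0 => [|i IH] f f0.
  rewrite big_ord_recl /= bin0 mul1r big1 ?addr0 // => k _.
  by rewrite bin0n mul0r.
have -> : f i.+1 = f i + fdiff f i by rewrite /fdiff addrC subrK.
rewrite (IH f f0) (IH (fdiff f)); last first.
  by move=> j; rewrite -iterSr iterS /fdiff !f0 subrr.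
rewrite big_ord_recl [X in _ + X]big_ord_recr /= -iterSr f0 mulr0 addr0.
rewrite [RHS]big_ord_recl !bin0 -addrA; congr (_ + _).
rewrite -big_split /=; apply: eq_bigr => k _.
by rewrite -iterSr /bump /= add1n binS natrD mulrDl.
Qed.

Lemma iter_fdiff_sum (I : Type) (r : seq I) k (c : I -> R) (F : I -> nat -> R) i :
  iter k fdiff (fun i => \sum_(j <- r) c j * F j i) i =
  \sum_(j <- r) c j * iter k fdiff (F j) i.
Proof.
elim: k i => //= k IH i; rewrite {1}/fdiff !IH -sumrB.
by apply: eq_bigr => j _; rewrite -mulrBr.
Qed.

Lemma iter_fdiff_eq0 k n f : (n <= k)%N -> (forall i, iter n fdiff f i = 0) ->
  forall i, iter k fdiff f i = 0.
Proof.
move=> /subnK <- f0; elim: (k - n)%N => [//|m IH] i.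
by rewrite addSn iterS /fdiff !IH subrr.
Qed.

(** The recursion satisfied by the moments of a random walk makes m_n a
    polynomial sequence of degree at most n: the term k = n is m_n(i) itself, so
    differencing leaves only m_0, ..., m_(n-1). *)
Lemma iter_fdiff_appell_eq0 (m : nat -> nat -> R) (mu : nat -> R) : mu 0%N = 1 ->
  (forall n i, m n i.+1 = \sum_(k < n.+1) 'C(n, k)%:R * mu (n - k)%N * m k i) ->
  forall n i, iter n.+1 fdiff (m n) i = 0.
Proof.
move=> mu0 mS; elim/ltn_ind => n IH i.
rewrite iterSr.
have -> : fdiff (m n) =
    (fun i => \sum_(k < n) ('C(n, k)%:R * mu (n - k)%N) * m k i).
  apply/funext => j; rewrite /fdiff mS big_ord_recr /= binn subnn mu0 !mul1r.
  by rewrite addrK.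
rewrite iter_fdiff_sum big1 // => k _.
by rewrite (iter_fdiff_eq0 (ltn_ord k) (IH k (ltn_ord k))) mulr0.
Qed.

End finite_differences.

(** * Binomial moments of the geometric law *)

Section binomial_series.
Variables (R : realType).

(** Summation by parts: the difference of C(i, k+1) in i is C(i, k).  The
    boundary term is kept exact, as it is also the general term of the series. *)
Lemma binomial_geometric_partial_sum (q : R) k N :
  (1 - q) * series (fun i => 'C(i, k.+1)%:R * q ^+ i) N + 'C(N, k.+1)%:R * q ^+ N
  = q * series (fun i => 'C(i, k)%:R * q ^+ i) N.
Proof.
elim: N => [|N IH].
  by rewrite /series /= !big_geq // !mulr0 bin0n mul0r addr0.
rewrite !seriesSr binS natrD [RHS]mulrDr -IH exprS; ring.
Qed.

(** Induction on k by means of the previous identity.  The boundary term is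
    nonnegative, so the identity first bounds the partial sums of the new series
    by the limit of the old one; convergence then forces the boundary term to 0,
    and the identity yields the value of the limit. *)
Lemma cvg_binomial_geometric (q : R) k : 0 <= q -> q < 1 ->
  series (fun i => 'C(i, k)%:R * q ^+ i) @ \oo --> q ^+ k / (1 - q) ^+ k.+1.
Proof.
move=> q0 q1; have p0 : 0 < 1 - q by rewrite subr_gt0.
elim: k => [|k IH].
  under eq_cvg => n.
    rewrite (_ : series _ n = series (geometric 1 q) n); last first.
      by apply: eq_bigr => i _; rewrite bin0.
    over.
  by rewrite expr0 expr1; apply: cvg_geometric_series; rewrite ger0_norm.
set u := fun i => 'C(i, k.+1)%:R * q ^+ i.
have u0 i : 0 <= u i by rewrite mulr_ge0 ?exprn_ge0.
have uE N : series u N =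
    (1 - q)^-1 * (q * series (fun i => 'C(i, k)%:R * q ^+ i) N - u N).
  rewrite -binomial_geometric_partial_sum -/u addrK mulKf //.
  by rewrite gt_eqF.
have cu : cvgn (series u).
  apply: (nondecreasing_is_cvgn (nondecreasing_series _)) => [n _ _|]; first exact: u0.
  exists ((1 - q)^-1 * (q * (q ^+ k / (1 - q) ^+ k.+1))) => _ [N _ <-].
  rewrite [leLHS](uE N) ler_wpM2l ?invr_ge0 ?(ltW p0) //.
  rewrite lerBlDr; apply: (@le_trans _ _ (q * (q ^+ k / (1 - q) ^+ k.+1))).
    rewrite ler_wpM2l// -(cvg_lim _ IH)//.
    apply: (nondecreasing_cvgn_le (nondecreasing_series _) (cvgP _ IH)) => i _ _.
    by rewrite mulr_ge0 ?exprn_ge0.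
  by rewrite lerDl u0.
have cv := cvg_series_cvg_0 cu.
rewrite (_ : series u = fun N =>
    (1 - q)^-1 * (q * series (fun i => 'C(i, k)%:R * q ^+ i) N - u N)); last first.
  by apply/funext => N; exact: uE.
have -> : q ^+ k.+1 / (1 - q) ^+ k.+2 =
    (1 - q)^-1 * (q * (q ^+ k / (1 - q) ^+ k.+1) - 0).
  by rewrite subr0 !exprS !invfM; ring.
by apply: cvgMr; apply: cvgB => //; apply: cvgMr.
Qed.

(** With q = x / (1 + x) the odds ratio q / (1 - q) is x. *)
Lemma geometric_binomial_moment (x : R) k : 0 <= x ->
  series (fun i => 'C(i, k)%:R * geometric_pmf (Defs.eta x) i.+1) @ \oo --> x ^+ k.
Proof.
move=> x0; have x1 : 0 < 1 + x by rewrite ltr_pwDl.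
have pE : 1 - x / (1 + x) = (1 + x)^-1 by field; rewrite gt_eqF.
have q0 : 0 <= x / (1 + x) by rewrite divr_ge0 ?(ltW x1).
have q1 : x / (1 + x) < 1 by rewrite -subr_gt0 pE invr_gt0.
have -> : series (fun i => 'C(i, k)%:R * geometric_pmf (Defs.eta x) i.+1) =
    (fun N => (1 + x)^-1 * series (fun i => 'C(i, k)%:R * (x / (1 + x)) ^+ i) N).
  apply/funext => N; rewrite /series /= big_distrr; apply: eq_bigr => i _ /=.
  by rewrite geometric_pmf_eta // mulrCA mul1r.
have -> : x ^+ k = (1 + x)^-1 *
    ((x / (1 + x)) ^+ k / (1 - x / (1 + x)) ^+ k.+1).
  rewrite pE exprS exprMn exprVn invfM !invrK.
  by field; rewrite expf_neq0 ?gt_eqF.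
by apply: cvgMr; exact: cvg_binomial_geometric.
Qed.

End binomial_series.

(** * Independence and product laws *)

Section independence.
Local Open Scope ereal_scope.
Context d (T : measurableType d) (R : realType) (P : probability T R).
Implicit Types X Z : {RV P >-> R}.

(** For fixed C, both sides are finite measures in D that agree on rectangles,
    so they are equal by uniqueness of the product measure.  Keeping the event C
    lets independence from the future survive the passage from (X, Z) to a
    function of (X, Z), which is what an induction on partial sums requires. *)
Lemma pair_law_on_event X Z (C : set T) : measurable C ->
  (forall A B : set R, measurable A -> measurable B ->
    P (X @^-1` A `&` Z @^-1` B `&` C) = P (X @^-1` A) * P (Z @^-1` B) * P C) ->
  forall D : set (R * R), measurable D ->
  P ((fun w => (X w, Z w)) @^-1` D `&` C) =
  (distribution P X \x distribution P Z) D * P C.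
Proof.
move=> mC XZC D mD.
have mXZ : measurable_fun [set: T] (fun w => (X w, Z w)).
  by apply: measurable_fun_pair.
have fC : (0 <= fine (P C))%R by rewrite fine_ge0.
(* P C is absorbed in the first factor of the product measure *)
pose c := NngNum fC.
have cE : c%:num%:E = P C by rewrite /= fineK// fin_num_measure.
have -> : (distribution P X \x distribution P Z) D * P C =
    (mscale c (distribution P X) \x distribution P Z) D.
  rewrite /product_measure1 ge0_integral_mscale//.
    by rewrite muleC -cE.
  exact: measurable_fun_xsection.
apply/esym; rewrite (@product_measure_unique _ _ _ _ _ _ _
  (pushforward (mrestr P mC) (fun w => (X w, Z w))))//.
move=> A B mA mB.
transitivity (P (X @^-1` A `&` Z @^-1` B `&` C)) => //.
by rewrite XZC// /= /mscale /= fineK ?fin_num_measure// muleC muleA.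
Qed.

Lemma pair_law_indep X Z :
  (forall A B : set R, measurable A -> measurable B ->
    P (X @^-1` A `&` Z @^-1` B) = P (X @^-1` A) * P (Z @^-1` B)) ->
  forall D : set (R * R), measurable D ->
  P ((fun w => (X w, Z w)) @^-1` D) =
  (distribution P X \x distribution P Z) D.
Proof.
move=> XZ D mD; rewrite -[_ @^-1` D]setIT (pair_law_on_event measurableT _ mD).
  by rewrite probability_setT mule1.
by move=> A B mA mB; rewrite setIT probability_setT mule1 XZ.
Qed.

(** The theorem of Fubini for the product of the two laws.  Integrability of the
    product is part of the conclusion: powers of a sum are expanded into such
    products, whose integrability is not known beforehand. *)
Lemma indep_expectationM X Z (f g : R -> R) :
  (forall A B : set R, measurable A -> measurable B ->
    P (X @^-1` A `&` Z @^-1` B) = P (X @^-1` A) * P (Z @^-1` B)) ->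
  measurable_fun [set: R] f -> measurable_fun [set: R] g ->
  P.-integrable setT (fun w => (f (X w))%:E) ->
  P.-integrable setT (fun w => (g (Z w))%:E) ->
  P.-integrable setT (fun w => (f (X w) * g (Z w))%:E) /\
  'E_P[fun w => (f (X w) * g (Z w))%R] =
    'E_P[fun w => f (X w)] * 'E_P[fun w => g (Z w)].
Proof.
move=> XZ mf mg intf intg.
have mXZ : measurable_fun [set: T] (fun w => (X w, Z w)).
  by apply: measurable_fun_pair.
pose h (p : R * R) := (f p.1 * g p.2)%:E.
have mh : measurable_fun [set: R * R] h.
  by apply/measurable_EFinP/measurable_funM; exact: measurableT_comp.
have mEf : measurable_fun [set: R] (EFin \o f) by exact/measurable_EFinP.
have mEg : measurable_fun [set: R] (EFin \o g) by exact/measurable_EFinP.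
have jointE (D : set (R * R)) : measurable D ->
  pushforward P (fun w => (X w, Z w)) D =
  (distribution P X \x distribution P Z) D.
  by move=> mD; exact: pair_law_indep.
have intdf : (distribution P X).-integrable setT (EFin \o f).
  exact: integrable_pushforward.
have intdg : (distribution P Z).-integrable setT (EFin \o g).
  exact: integrable_pushforward.
have inth2 : (distribution P X \x distribution P Z).-integrable setT h.
  apply/integrable12ltyP => //.
  have mNg : measurable_fun [set: R] (fun y => `|(g y)%:E|).
    exact: measurableT_comp.
  rewrite (eq_integral (fun x =>
    `|(f x)%:E| * \int[distribution P Z]_y `|(g y)%:E|)); last first.
    move=> x _; rewrite -ge0_integralZl//.
    by apply: eq_integral => y _; rewrite /h /= normrM EFinM.
  rewrite ge0_integralZr//; last 2 first.
    exact: measurableT_comp.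
    exact: integral_ge0.
  apply: lte_mul_pinfty.
  - exact: integral_ge0.
  - by rewrite ge0_fin_numE; [case/integrableP: intdf|exact: integral_ge0].
  - by case/integrableP: intdg.
have inth : P.-integrable setT (h \o (fun w => (X w, Z w))).
  apply/integrableP; split; first exact: measurableT_comp.
  rewrite (_ : \int[P]_w _ =
      \int[pushforward P (fun w => (X w, Z w))]_p `|h p|); last first.
    rewrite ge0_integral_pushforward//.
    exact: measurableT_comp.
  rewrite (eq_measure_integral (distribution P X \x distribution P Z)).
    by case/integrableP: inth2.
  by move=> D mD _; exact: jointE.
split => //.
transitivity (\int[pushforward P (fun w => (X w, Z w))]_p h p).
  by rewrite integral_pushforward// unlock.
rewrite (eq_measure_integral (distribution P X \x distribution P Z)); last first.
  by move=> D mD _; exact: jointE.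
rewrite -integral12_prod_meas1//.
rewrite /fubini_F (eq_integral (fun x =>
    (f x)%:E * \int[distribution P Z]_y (g y)%:E)); last first.
  by move=> x _; rewrite -integralZl.
rewrite unlock -(integral_distribution mEf intf) -(integral_distribution mEg intg).
rewrite -{1}(fineK (integrable_fin_num _ intdg))// integralZr//.
by rewrite fineK// integrable_fin_num.
Qed.
End independence.

(** * Partial sums of independent random variables *)

Section partial_sums.
Local Open Scope ereal_scope.
Context d (T : measurableType d) (R : realType) (P : probability T R).
Variable Ys : nat -> {RV P >-> R}.

Lemma measurable_partial_sum i : measurable_fun [set: T] (partial_sum Ys i).
Proof. by apply: measurable_sum => j; exact: measurable_funPT. Qed.

HB.instance Definition _ i := isMeasurableFun.Build _ _ _ _ (partial_sum Ys i)
  (measurable_partial_sum i).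

(** S_i is independent of the joint behaviour of the later variables.  The later
    variables have to be carried along, since the hypothesis used to
    pass from S_i to S_i + Y_(i+1) is the independence of S_i from the event
    that combines Y_(i+1) with the variables after it. *)
Lemma partial_sum_indep i (J : seq nat) (B : nat -> set R) (A : set R) :
  mutually_independent Ys -> uniq J -> all (leq i) J ->
  (forall j, measurable (B j)) -> measurable A ->
  P (partial_sum Ys i @^-1` A `&` \bigcap_(j in [set` J]) (Ys j @^-1` B j)) =
  P (partial_sum Ys i @^-1` A) * P (\bigcap_(j in [set` J]) (Ys j @^-1` B j)).
Proof.
move=> indep; elim: i J B A => [|i IH] J B A uJ iJ mB mA.
  have [A0|A0] := pselect (A 0%R).
    have -> : partial_sum Ys 0 @^-1` A = setT.
      by apply/seteqP; split => // w _; rewrite /preimage /= /partial_sum big_ord0.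
    by rewrite setTI probability_setT mul1e.
  have -> : partial_sum Ys 0 @^-1` A = set0.
    by apply/seteqP; split => // w; rewrite /preimage /= /partial_sum big_ord0.
  by rewrite set0I measure0 mul0e.
have step (K : seq nat) : uniq K -> all (leq i.+1) K -> forall A1 B1 : set R,
    measurable A1 -> measurable B1 ->
    P (partial_sum Ys i @^-1` A1 `&` Ys i @^-1` B1 `&`
       \bigcap_(j in [set` K]) (Ys j @^-1` B j)) =
    P (partial_sum Ys i @^-1` A1) * P (Ys i @^-1` B1) *
    P (\bigcap_(j in [set` K]) (Ys j @^-1` B j)).
  move=> uK iK A1 B1 mA1 mB1.
  have iNK : i \notin K.
    by apply/negP => /(allP iK); rewrite ltnn.
  pose B' j := if j == i then B1 else B j.
  have mB' j : measurable (B' j) by rewrite /B'; case: ifP.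
  have B'K j : j \in K -> B' j = B j.
    by rewrite /B'; case: eqP => // -> iK'; rewrite iK' in iNK.
  have BE : \bigcap_(j in [set` i :: K]) (Ys j @^-1` B' j) =
      Ys i @^-1` B1 `&` \bigcap_(j in [set` K]) (Ys j @^-1` B j).
    rewrite !bigcap_seq big_cons {1}/B' eqxx; congr (_ `&` _).
    by apply: eq_big_seq => j jK; rewrite B'K.
  rewrite -setIA -BE IH//=; last 2 first.
  - by rewrite iNK.
  - by rewrite leqnn; apply: sub_all iK => j /ltnW.
  rewrite !indep//=; last by rewrite iNK.
  rewrite big_cons {1}/B' eqxx muleA; congr (_ * _).
  by apply: eq_big_seq => j jK; rewrite B'K.
have mC : measurable (\bigcap_(j in [set` J]) (Ys j @^-1` B j)).
  by apply: fin_bigcap_measurable => // j _; exact: measurable_funPTI.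
pose D := (fun p : R * R => (p.1 + p.2)%R) @^-1` A.
have mD : measurable D.
  by rewrite -[D]setTI; apply: measurable_funD => //.
have -> : partial_sum Ys i.+1 @^-1` A =
    (fun w => (partial_sum Ys i w, Ys i w)) @^-1` D.
  by apply/seteqP; split => w;
    rewrite /D /preimage /= /partial_sum big_ord_recr.
rewrite (pair_law_on_event mC (step J uJ iJ))// pair_law_indep// => A1 B1 mA1 mB1.
have := step [::] isT isT A1 B1 mA1 mB1.
by rewrite set_nil bigcap_set0 setIT probability_setT mule1.
Qed.

Lemma partial_sum_indep_next i (A B : set R) : mutually_independent Ys ->
  measurable A -> measurable B ->
  P (partial_sum Ys i @^-1` A `&` Ys i @^-1` B) =
  P (partial_sum Ys i @^-1` A) * P (Ys i @^-1` B).
Proof.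
move=> indep mA mB.
have := @partial_sum_indep i [:: i] (fun=> B) A indep isT.
by rewrite /= leqnn set_cons1 bigcap_set1; apply.
Qed.

Variable mu : nat -> R.
Hypothesis indep : mutually_independent Ys.
Hypothesis intY : forall i k, P.-integrable setT (fun w => (Ys i w ^+ k)%:E).
Hypothesis EY : forall i k, 'E_P[fun w => (Ys i w ^+ k)%R] = (mu k)%:E.

Let partial_sumSX i n w : ((partial_sum Ys i.+1 w ^+ n)%R)%:E =
  \sum_(k < n.+1) (('C(n, k)%:R)%R)%:E * (partial_sum Ys i w ^+ k * Ys i w ^+ (n - k))%:E.
Proof.
rewrite /partial_sum big_ord_recr /= addrC exprDn -sumEFin.
by apply: eq_bigr => k _; rewrite -EFinM mulr_natl mulrC.
Qed.

Let partial_sum_momentM i n (IH : forall k, P.-integrable setT (fun w => (partial_sum Ys i w ^+ k)%:E)) k :=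
  @indep_expectationM _ T R P (partial_sum Ys i) (Ys i) (fun y => y ^+ k)%R
  (fun y => y ^+ (n - k))%R (fun A B mA mB => partial_sum_indep_next i indep mA mB)
  (exprn_measurable _) (exprn_measurable _) (IH k) (intY i (n - k)).

(** The binomial expansion writes a power of S_(i+1) as a combination of
    products of powers of the independent variables S_i and Y_(i+1). *)
Lemma integrable_partial_sumX i n :
  P.-integrable setT (fun w => (partial_sum Ys i w ^+ n)%:E).
Proof.
elim: i n => [|i IH] n.
  rewrite (_ : (fun w => _) = cst (0 ^+ n)%:E); last first.
    by apply/funext => w; rewrite /partial_sum big_ord0.
  exact: finite_measure_integrable_cst.
under eq_fun do rewrite partial_sumSX.
apply: integrable_sum => // k _; apply: integrableZl => //.
by have [] := partial_sum_momentM n IH k.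
Qed.

Lemma sum_momentS i n : sum_moment Ys i.+1 n =
  (\sum_(k < n.+1) 'C(n, k)%:R * mu (n - k) * sum_moment Ys i k)%R.
Proof.
have IH := integrable_partial_sumX i.
rewrite /sum_moment unlock.
under eq_integral do rewrite partial_sumSX.
rewrite integral_sum//; last first.
  by move=> k; apply: integrableZl => //; have [] := partial_sum_momentM n IH k.
rewrite -sum_fine; last first.
  move=> k _; rewrite integrable_fin_num//; apply: integrableZl => //.
  by have [] := partial_sum_momentM n IH k.
apply: eq_bigr => k _.
have [intk Ek] := partial_sum_momentM n IH k.
rewrite integralZl// fineM//; last exact: integrable_fin_num.
rewrite -mulrA; congr (_ * _)%R.
move: Ek; rewrite EY unlock => ->.
rewrite fineM//; last exact: integrable_fin_num.
by rewrite mulrC.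
Qed.

End partial_sums.

(** * Laws of random variables and densities *)

(** Change of variables for the law of X without integrability: it holds for
    the positive and the negative part, and the integral of any function is the
    difference of the integrals of these two. *)
Lemma integral_distributionE d d' (T : measurableType d) (T' : measurableType d')
    (R : realType) (P : probability T R) (X : {RV P >-> T'}) (f : T' -> \bar R) :
  measurable_fun [set: T'] f ->
  (\int[distribution P X]_y f y = \int[P]_w f (X w))%E.
Proof.
move=> mf; rewrite integralE [RHS]integralE !ge0_integral_distribution//.
- by congr (_ - _)%E; apply: eq_integral => w _; rewrite /= ?funeposE ?funenegE.
- exact/measurable_funeneg.
- exact/measurable_funepos.
Qed.

Section density.
Local Open Scope ereal_scope.
Context d (T : measurableType d) (R : realType).
Variables (nu : {finite_measure set T -> \bar R})
  (mu : {sigma_finite_measure set T -> \bar R}) (h : T -> R).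
Hypotheses (mh : measurable_fun [set: T] h) (h0 : forall x, (0 <= h x)%R).
Hypothesis nuE : forall A, measurable A -> nu A = \int[mu]_(x in A) (h x)%:E.

Let mEh : measurable_fun [set: T] (EFin \o h).
Proof. exact/measurable_EFinP. Qed.

Let numu : nu `<< mu.
Proof.
apply/null_content_dominatesP => A mA muA0.
by rewrite nuE// null_set_integral//; exact: measurable_funTS.
Qed.

(** By the uniqueness of densities, h agrees almost everywhere with the
    derivative provided by the theorem of Radon and Nikodym, for which the
    change of variables is known. *)
Lemma ge0_integral_density (g : T -> \bar R) : measurable_fun setT g ->
  (forall x, 0 <= g x) -> \int[nu]_x g x = \int[mu]_x (g x * (h x)%:E).
Proof.
move=> mg g0.
have intf := Radon_Nikodym_SigmaFinite.f_integrable numu.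
rewrite -(Radon_Nikodym_SigmaFinite.change_of_variables numu)//.
apply: ae_eq_integral => //.
- by apply: emeasurable_funM => //; exact: measurable_int intf.
- exact: emeasurable_funM.
- apply: ae_eqe_mul2l; apply: integral_ae_eq => // E _ mE.
  by rewrite -nuE// -Radon_Nikodym_SigmaFinite.f_integral.
Qed.

Lemma integral_density (g : T -> \bar R) : measurable_fun setT g ->
  \int[nu]_x g x = \int[mu]_x (g x * (h x)%:E).
Proof.
move=> mg; rewrite integralE [RHS]integralE.
rewrite !ge0_integral_density//; [|exact: measurable_funeneg|exact: measurable_funepos].
congr (_ - _); apply: eq_integral => x _.
- by rewrite !funeposE maxe_pMl ?mul0e ?lee_fin.
- by rewrite !funenegE -mulNe maxe_pMl ?mul0e ?lee_fin.
Qed.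

End density.

(** * The exponential law and its moments *)

Section exponential_law.
Context {R : realType}.
Local Notation mu := (@lebesgue_measure R).

Lemma expectation_exponential d (T : measurableType d) (Q : probability T R)
  (V : {RV Q >-> R}) (g : R -> R) : standard_exponential V ->
  measurable_fun [set: R] g ->
  ('E_Q[fun w => g (V w)] =
   \int[mu]_(x in `[0%R, +oo[) (g x * expR (- x))%:E)%E.
Proof.
move=> hV mg; rewrite unlock.
(* Lebesgue measure lives on the copy of R that carries the Borel sets
   generated by half-open intervals; W is V with values in that copy *)
have mV : measurable_fun [set: T] (V : T -> measurableTypeR R).
  exact: measurable_funPT V.
pose W : {RV Q >-> measurableTypeR R} :=
  HB.pack (V : T -> measurableTypeR R) (isMeasurableFun.Build _ _ _ _ _ mV).
have mEg : measurable_fun [set: measurableTypeR R] (EFin \o g).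
  exact/measurable_EFinP.
rewrite -(integral_distributionE W mEg).
rewrite (@integral_density _ _ _ (distribution Q W) mu (exponential_pdf 1))//.
- rewrite [RHS]integral_mkcond; apply: eq_integral => x _.
  rewrite /exponential_pdf /= !patchE; case: ifPn => _.
    by rewrite mul1r mulN1r.
  by rewrite mule0.
- exact: measurable_exponential_pdf.
- by move=> x; rewrite exponential_pdf_ge0.
Qed.

(** The primitive of x^k e^(-x) that tends to 0 at infinity, in the recursive
    form that integration by parts gives. *)
Fixpoint gamma_primitive (k : nat) (x : R) : R :=
  if k is k'.+1 then k%:R * gamma_primitive k' x - x ^+ k * expR (- x)
  else - expR (- x).

Let is_derive_expRN (x : R) : is_derive x 1 (fun y => expR (- y)) (- expR (- x)).
Proof.
by apply: is_derive_eq; rewrite mulrN1.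
Qed.

Lemma is_derive_gamma_primitive k (x : R) :
  is_derive x 1 (gamma_primitive k) (x ^+ k * expR (- x)).
Proof.
elim: k => [|k IH].
  have := is_deriveN (is_derive_expRN x).
  by rewrite opprK expr0 mul1r.
have dk := is_deriveB (is_deriveZ k.+1%:R IH)
  (is_deriveM (is_deriveX k.+1 (is_derive_id x 1)) (is_derive_expRN x)).
have -> : gamma_primitive k.+1 =
    k.+1%:R \*: gamma_primitive k - (id ^+ k.+1) * (fun y => expR (- y)).
  by apply/funext => y; rewrite !fctE.
apply: (is_derive_eq dk).
by rewrite !fctE /GRing.scale /=; ring.
Qed.

Lemma gamma_primitive0 k : gamma_primitive k 0 = - k`!%:R.
Proof.
elim: k => [|k IH] /=; first by rewrite oppr0 expR0.
by rewrite IH exprS !mul0r subr0 mulrN -natrM.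
Qed.

(** One term of the exponential series, x^(k+1) / (k+1)! <= e^x, bounds the
    product by (k+1)! / x. *)
Lemma cvgy_exprn_expRN k : x ^+ k * expR (- x) @[x --> +oo] --> (0 : R).
Proof.
apply: (@squeeze_cvgr _ _ _ _ (fun=> 0) (fun x => k.+1`!%:R * x^-1)).
- near=> x; have x0 : 0 < x by near: x; exact: nbhs_pinfty_gt.
  rewrite mulr_ge0 ?exprn_ge0 ?expR_ge0 ?(ltW x0)//=.
  rewrite expRN ler_pdivrMr ?expR_gt0//.
  have : x ^+ k.+1 / k.+1`!%:R <= expR x.
    by rewrite (le_trans _ (expR_ge1Dxn k (ltW x0)))// lerDr.
  rewrite ler_pdivrMr ?ltr0n ?fact_gt0// exprS => H.
  by rewrite -mulrA mulrCA ler_pdivlMl// mulrC [leRHS]mulrC in H *.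
- exact: cvg_cst.
- rewrite -[X in _ --> X](mulr0 k.+1`!%:R).
  apply: cvgMr; apply/gtr0_cvgV0; last exact: cvg_id.
  exact: nbhs_pinfty_gt.
Unshelve. all: by end_near. Qed.

Lemma cvgy_gamma_primitive k : gamma_primitive k x @[x --> +oo] --> (0 : R).
Proof.
elim: k => [|k IH] /=; first by rewrite -oppr0; apply: cvgN; exact: cvgr_expR.
rewrite -[X in _ --> X](subr0 (0 : R)) -{1}(mulr0 k.+1%:R).
by apply: cvgB; [exact: cvgMr|exact: cvgy_exprn_expRN].
Qed.

Lemma integral_exprn_expRN k :
  (\int[mu]_(v in `[0%R, +oo[) (v ^+ k * expR (- v))%:E = (k`!%:R)%:E)%E.
Proof.
rewrite (@ge0_continuous_FTC2y _ _ (gamma_primitive k) _ 0).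
- by rewrite gamma_primitive0 EFinN oppeK add0e.
- by move=> x x0; rewrite mulr_ge0 ?exprn_ge0 ?expR_ge0.
- apply: continuous_subspaceT => x; apply: cvgM; first exact: exprn_continuous.
  by apply: (@continuous_comp _ _ _ -%R); [exact: opp_continuous|exact: continuous_expR].
- exact: cvgy_gamma_primitive.
- by move=> x _; have [] := is_derive_gamma_primitive k x.
- apply: cvg_at_right_filter.
  have [/derivable1_diffP/differentiable_continuous + _] :=
    is_derive_gamma_primitive k 0.
  exact.
- move=> x _; by rewrite derive1E; have [] := is_derive_gamma_primitive k x.
Qed.

End exponential_law.

Lemma integrable_exprn_expRN (R : realType) k :
  (@lebesgue_measure R).-integrable `[0%R, +oo[
    (fun v => (v ^+ k * expR (- v))%:E).
Proof.
apply/integrableP; split.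
  apply/measurable_EFinP/measurable_funTS/measurable_funM.
    exact: exprn_measurable.
  by apply: measurableT_comp => //; exact: measurable_expR.
rewrite (_ : integral _ _ _ = (k`!%:R)%:E) ?ltry//.
rewrite -integral_exprn_expRN; apply: eq_integral => v.
rewrite inE/= in_itv/= andbT => v0.
by rewrite ger0_norm// mulr_ge0 ?exprn_ge0 ?expR_ge0.
Qed.

(** * Identically distributed variables *)

Lemma same_distribution_integral d d' (T : measurableType d)
    (T' : measurableType d') (R : realType) (P : probability T R)
    (P' : probability T' R) (X : {RV P >-> R}) (X' : {RV P' >-> R})
    (f : R -> R) : same_distribution X X' -> measurable_fun [set: R] f ->
  (\int[P]_w (f (X w))%:E = \int[P']_w (f (X' w))%:E)%E.
Proof.
move=> XX' mf; have mEf : measurable_fun [set: R] (EFin \o f).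
  exact/measurable_EFinP.
rewrite -(integral_distributionE X mEf) -(integral_distributionE X' mEf).
by apply: eq_measure_integral => A mA _; exact: XX'.
Qed.

Section identically_distributed.
Context d d' (T : measurableType d) (T' : measurableType d') (R : realType)
  (P : probability T R) (P' : probability T' R).

Lemma iid_integrableX (Y : {RV P >-> R}) (Ys : nat -> {RV P' >-> R}) i k :
  class_G Y -> iid_copies Y Ys ->
  P'.-integrable setT (fun w => (Ys i w ^+ k)%:E).
Proof.
move=> [Yk _] [_ YsY]; apply/integrableP; split.
  by apply/measurable_EFinP/measurable_funX; exact: measurable_funPT.
have mk : measurable_fun [set: R] (fun y : R => `|y ^+ k|).
  by apply: measurableT_comp => //; exact: exprn_measurable.
rewrite (same_distribution_integral (f := fun y => `|y ^+ k|) (YsY i) mk).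
by have := Yk k; rewrite unlock; under eq_integral do rewrite -normrX.
Qed.

Lemma iid_expectationX (Y : {RV P >-> R}) (Ys : nat -> {RV P' >-> R}) i k :
  class_G Y -> iid_copies Y Ys ->
  ('E_P'[fun w => (Ys i w ^+ k)%R] = (fine 'E_P[fun w => (Y w ^+ k)%R])%:E)%E.
Proof.
move=> GY iidY; have := integrable_fin_num measurableT (iid_integrableX i k GY iidY).
have mk : measurable_fun [set: R] (fun y : R => y ^+ k) by exact: exprn_measurable.
rewrite unlock (same_distribution_integral (f := fun y => y ^+ k) (iidY.2 i) mk).
by move=> ?; rewrite fineK.
Qed.

End identically_distributed.

(** * Fubini and Bell polynomials *)

Section iid_sums.
Context d d' (T : measurableType d) (T' : measurableType d') (R : realType)
  (P : probability T R) (P' : probability T' R).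
Variables (Y : {RV P >-> R}) (Ys : nat -> {RV P' >-> R}).
Hypotheses (GY : class_G Y) (iidY : iid_copies Y Ys).

(** Newton expansion of the polynomial i |-> E[S_i^n]; its coefficients, the
    differences at 0, are the Stirling numbers times factorials. *)
Lemma sum_momentE n i : sum_moment Ys i n =
  \sum_(k < n.+1) 'C(i, k)%:R * (k`!%:R * stirling2 Ys n k).
Proof.
pose mu k := fine 'E_P[fun w => (Y w ^+ k)%R]%E.
have EY j k : 'E_P'[fun w => (Ys j w ^+ k)%R]%E = (mu k)%:E.
  exact: iid_expectationX.
have mu0 : mu 0%N = 1.
  by rewrite /mu; under eq_fun do rewrite expr0; rewrite expectation_cst.
have rec n' j := sum_momentS iidY.1
  (fun i k => iid_integrableX i k GY iidY) EY j n'.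
have := newton_forward (iter_fdiff_appell_eq0 (m := fun n i => sum_moment Ys i n) mu0 rec n).
move=> /(_ i) ->; apply: eq_bigr => k _; congr (_ * _).
by rewrite iter_fdiff0E /stirling2 mulVKf// pnatr_eq0 -lt0n fact_gt0.
Qed.

(** After the Newton expansion of the moments, the series is a finite
    combination of the binomial moments of the geometric law. *)
Lemma cvg_fubini n (x : R) : 0 <= x ->
  series (fubini_term Ys n x) @ \oo -->
  \sum_(k < n.+1) k`!%:R * stirling2 Ys n k * x ^+ k.
Proof.
move=> x0.
have -> : series (fubini_term Ys n x) = (fun N => \sum_(k < n.+1)
    k`!%:R * stirling2 Ys n k *
    series (fun i => 'C(i, k)%:R * geometric_pmf (Defs.eta x) i.+1) N).
  apply/funext => N; rewrite /series /=.
  under [RHS]eq_bigr do rewrite big_distrr.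
  rewrite exchange_big /=; apply: eq_bigr => i _.
  rewrite /fubini_term sum_momentE big_distrl /=.
  by apply: eq_bigr => k _; rewrite -[LHS]mulrA [RHS]mulrCA.
apply: cvg_big => [|k _]; first exact: add_continuous.
apply: cvgMr; exact: geometric_binomial_moment.
Qed.

End iid_sums.

Lemma integral_bell_expRN d (T : measurableType d) (R : realType)
    (P : probability T R) (Ys : nat -> {RV P >-> R}) n (x : R) :
  (\int[lebesgue_measure]_(v in `[0%R, +oo[) (bell Ys n (x * v) * expR (- v))%:E =
   (\sum_(k < n.+1) k`!%:R * stirling2 Ys n k * x ^+ k)%:E)%E.
Proof.
transitivity (\int[lebesgue_measure]_(v in `[0%R, +oo[)
    \sum_(k < n.+1) (stirling2 Ys n k * x ^+ k)%:E * (v ^+ k * expR (- v))%:E)%E.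
  apply: eq_integral => v _; rewrite /bell big_distrl /= -sumEFin.
  by apply: eq_bigr => k _; rewrite -EFinM exprMn !mulrA.
rewrite integral_sum//; last first.
  by move=> k; apply: integrableZl => //; exact: integrable_exprn_expRN.
rewrite -sumEFin; apply: eq_bigr => k _.
rewrite integralZl//; last exact: integrable_exprn_expRN.
by rewrite integral_exprn_expRN -EFinM mulrC mulrA.
Qed.

(* Both equalities are in the extended reals and the left-most member is
   finite, so they also assert that the integral and the expectation exist. *)
Theorem proposition2p2 (R : realType)
  (d : measure_display) (T : measurableType d) (P : probability T R)
  (Y : {RV P >-> R})
  (d' : measure_display) (T' : measurableType d') (P' : probability T' R)
  (Ys : nat -> {RV P' >-> R})
  (dV : measure_display) (TV : measurableType dV) (Q : probability TV R)
  (V : {RV Q >-> R})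
  (hY : class_G Y) (hYs : iid_copies Y Ys) (hV : standard_exponential V)
  (n : nat) (x : R) (hx : 0 <= x) :
  [/\ cvgn (series (fubini_term Ys n x)),
      ((fubini Ys n x)%:E =
        \int[lebesgue_measure]_(v in `[0%R, +oo[)
          (bell Ys n (x * v) * expR (- v))%R%:E)%E
    & (\int[lebesgue_measure]_(v in `[0%R, +oo[)
          (bell Ys n (x * v) * expR (- v))%R%:E
        = 'E_Q[fun w => bell Ys n (x * V w)%R])%E].
Proof.
have W := cvg_fubini (n := n) hY hYs hx.
split.
- exact: cvgP W.
- by rewrite integral_bell_expRN /fubini (cvg_lim _ W).
- apply/esym; apply: (expectation_exponential (g := fun v => bell Ys n (x * v)) hV).
  apply: measurable_sum => k; apply: measurable_funM => //.
  by apply: measurable_funX; exact: measurable_funM.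
Qed.
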